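(* Let $\mathcal{A}$ be a $(\mathbb{Z}_2)^n$-graded quasialgebra with associated functions $\beta$ and $\phi$. The following conditions are equivalent: (i) the function $\phi$ is symmetric, i.e. $\phi(x,y,z)=\phi(y,x,z)=\phi(x,z,y)$ for all $x,y,z\in(\mathbb{Z}_2)^n$; (ii) $\mathcal{A}$ has a generating function.
   Context: Let $\mathbb{K}=\mathbb{R}$ or $\mathbb{C}$ and let $f:(\mathbb{Z}_2)^n\times(\mathbb{Z}_2)^n\to\mathbb{Z}_2$ be a function with $f(0,\cdot)=f(\cdot,0)=0$ (not necessarily a 2-cocycle). The twisted group algebra $(\mathbb{K}[(\mathbb{Z}_2)^n],f)$ is the unital $\mathbb{K}$-algebra with basis $u_x$, $x\in(\mathbb{Z}_2)^n$, and product $u_x\cdot u_y=(-1)^{f(x,y)}u_{x+y}$. It determines functions $\beta:((\mathbb{Z}_2)^n)^2\to\mathbb{Z}_2$ and $\phi:((\mathbb{Z}_2)^n)^3\to\mathbb{Z}_2$ by $u_x\cdot u_y=(-1)^{\beta(x,y)}u_y\cdot u_x$ and $u_x\cdot(u_y\cdot u_z)=(-1)^{\phi(x,y,z)}(u_x\cdot u_y)\cdot u_z$; that is, $\beta(x,y)=f(x,y)+f(y,x)$ and $\phi(x,y,z)=f(y,z)+f(x+y,z)+f(x,y+z)+f(x,y)$. The algebra together with the structure $(\beta,\phi)$ is called a $(\mathbb{Z}_2)^n$-graded quasialgebra. A function $\alpha:(\mathbb{Z}_2)^n\to\mathbb{Z}_2$ is a generating function if for all $x,y,z$: $\beta(x,y)=\alpha(x+y)+\alpha(x)+\alpha(y)$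 and $\phi(x,y,z)=\alpha(x+y+z)+\alpha(x+y)+\alpha(x+z)+\alpha(y+z)+\alpha(x)+\alpha(y)+\alpha(z)$. *)

(* Defs.v *)
From HB Require Import structures.
From mathcomp Require Import all_boot all_order all_algebra.
From mathcomp Require Import complex.
From mathcomp Require Import reals.

Set Implicit Arguments.
Unset Strict Implicit.
Unset Printing Implicit Defensive.

Import GRing.Theory.
Local Open Scope ring_scope.

Variant scalar_kind := RealScalars | ComplexScalars.

Definition scalars (R : realType) (k : scalar_kind) : fieldType :=
  match k with
  | RealScalars => R : fieldType
  | ComplexScalars => R[i] : fieldType
  end.

Notation "''Z2^' n" := ('rV['Z_2]_n)
  (at level 8, n at level 2, format "''Z2^' n") : type_scope.

Definition z2sign (K : fieldType) (b : 'Z_2) : K := (-1) ^+ (b : nat).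

(* The underlying vector space K[(Z_2)^n].  The twisted product is in general
   not associative, so it is a plain binary operation [tw_mul] rather than a
   ring structure. *)
Definition group_space (K : fieldType) (n : nat) := {ffun 'Z2^n -> K^o}.

Definition tw_basis (K : fieldType) (n : nat) (x : 'Z2^n) : group_space K n :=
  [ffun y => (y == x)%:R].

(* The bilinear extension of u_x u_y = (-1)^f(x,y) u_(x+y). *)
Definition tw_mul (K : fieldType) (n : nat) (f : 'Z2^n -> 'Z2^n -> 'Z_2)
    (a b : group_space K n) : group_space K n :=
  \sum_x \sum_y (a x * b y * z2sign K (f x y)) *: tw_basis K (x + y).

(* beta and phi are fields constrained by the defining relations in the
   algebra; [qa_betaE] and [qa_phiE] show that f determines them if 2 <> 0, and
   [quasialgebra_of] that they always exist. *)
Record quasialgebra (K : fieldType) (n : nat) := Quasialgebra {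
  qa_twist : 'Z2^n -> 'Z2^n -> 'Z_2;
  qa_beta : 'Z2^n -> 'Z2^n -> 'Z_2;
  qa_phi : 'Z2^n -> 'Z2^n -> 'Z2^n -> 'Z_2;
  qa_twist0l : forall x, qa_twist 0 x = 0;
  qa_twist0r : forall x, qa_twist x 0 = 0;
  qa_betaP : forall x y,
    tw_mul qa_twist (tw_basis K x) (tw_basis K y) =
    z2sign K (qa_beta x y) *: tw_mul qa_twist (tw_basis K y) (tw_basis K x);
  qa_phiP : forall x y z,
    tw_mul qa_twist (tw_basis K x)
      (tw_mul qa_twist (tw_basis K y) (tw_basis K z)) =
    z2sign K (qa_phi x y z) *:
      tw_mul qa_twist (tw_mul qa_twist (tw_basis K x) (tw_basis K y))
        (tw_basis K z)
}.

Definition phi_symmetric (K : fieldType) (n : nat) (A : quasialgebra K n) :=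
  forall x y z : 'Z2^n,
    qa_phi A x y z = qa_phi A y x z /\ qa_phi A x y z = qa_phi A x z y.

Definition generating_function (K : fieldType) (n : nat)
    (A : quasialgebra K n) (alpha : 'Z2^n -> 'Z_2) :=
  (forall x y, qa_beta A x y = alpha (x + y) + alpha x + alpha y) /\
  (forall x y z, qa_phi A x y z =
     alpha (x + y + z) + alpha (x + y) + alpha (x + z) + alpha (y + z)
     + alpha x + alpha y + alpha z).

Lemma tw_basisE (K : fieldType) (n : nat) (x y : 'Z2^n) :
  tw_basis K x y = (y == x)%:R.
Proof. by rewrite ffunE. Qed.

Lemma tw_scaleE (K : fieldType) (n : nat) (c : K) (a : group_space K n)
    (x : 'Z2^n) :
  (c *: a) x = c * a x.
Proof. by rewrite ffunE. Qed.

Lemma tw_basis_decomp (K : fieldType) (n : nat) (a : group_space K n) :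
  a = \sum_x a x *: tw_basis K x.
Proof.
apply/ffunP => z; rewrite sum_ffunE (bigD1 z) //= tw_scaleE tw_basisE eqxx.
rewrite big1 ?addr0 ?mulr1 // => x nxz.
by rewrite tw_scaleE tw_basisE eq_sym (negPf nxz) mulr0.
Qed.

Lemma z2signD (K : fieldType) (b c : 'Z_2) :
  z2sign K (b + c) = z2sign K b * z2sign K c.
Proof.
case: b c => [[|[|[]]] //= ?] [[|[|[]]] //= ?];
  by rewrite /z2sign /= ?(expr0, expr1, mul1r, mulr1, mulrNN).
Qed.

Lemma z2sign_inj (K : fieldType) :
  (2%:R : K) != 0 -> injective (z2sign K).
Proof.
move=> nz2; have n1 : (1 : K) != -1.
  by rewrite -subr_eq0 opprK -(natrD K 1 1).
case=> [[|[|[]]] //= i] [[|[|[]]] //= j];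
  rewrite /z2sign /= ?expr0 ?expr1 => e; apply/val_inj => //=;
  by case/eqP: n1; rewrite e ?opprK.
Qed.

Lemma z2sign_neq0 (K : fieldType) (b : 'Z_2) : z2sign K b != 0.
Proof. by rewrite /z2sign expf_neq0 // oppr_eq0 oner_eq0. Qed.

Lemma tw_mulZl (K : fieldType) (n : nat) (f : 'Z2^n -> 'Z2^n -> 'Z_2)
    (c : K) (a b : group_space K n) :
  tw_mul f (c *: a) b = c *: tw_mul f a b.
Proof.
rewrite /tw_mul scaler_sumr; apply: eq_bigr => x _.
rewrite scaler_sumr; apply: eq_bigr => y _.
by rewrite scalerA tw_scaleE -!mulrA.
Qed.

Lemma tw_mulZr (K : fieldType) (n : nat) (f : 'Z2^n -> 'Z2^n -> 'Z_2)
    (c : K) (a b : group_space K n) :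
  tw_mul f a (c *: b) = c *: tw_mul f a b.
Proof.
rewrite /tw_mul scaler_sumr; apply: eq_bigr => x _.
rewrite scaler_sumr; apply: eq_bigr => y _.
by rewrite scalerA tw_scaleE mulrCA -!mulrA.
Qed.

Lemma tw_mul_basis (K : fieldType) (n : nat) (f : 'Z2^n -> 'Z2^n -> 'Z_2)
    (x y : 'Z2^n) :
  tw_mul f (tw_basis K x) (tw_basis K y) = z2sign K (f x y) *: tw_basis K (x + y).
Proof.
rewrite /tw_mul (bigD1 x) //= (bigD1 y) //= !tw_basisE !eqxx !mul1r.
rewrite big1 => [|y' ny]; last by rewrite !tw_basisE (negPf ny) mulr0 mul0r scale0r.
rewrite big1 => [|x' nx]; first by rewrite !addr0.
by apply: big1 => y' _; rewrite !tw_basisE (negPf nx) !mul0r scale0r.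
Qed.

Lemma tw_mul1l (K : fieldType) (n : nat) (f : 'Z2^n -> 'Z2^n -> 'Z_2) :
  (forall x, f 0 x = 0) ->
  forall a : group_space K n, tw_mul f (tw_basis K 0) a = a.
Proof.
move=> f0 a; rewrite [RHS]tw_basis_decomp /tw_mul (bigD1 0) //=.
rewrite [X in _ + X]big1 => [|x nx]; last first.
  by apply: big1 => y _; rewrite !tw_basisE (negPf nx) !mul0r scale0r.
rewrite addr0; apply: eq_bigr => y _.
by rewrite !tw_basisE eqxx mul1r f0 add0r /z2sign expr0 mulr1.
Qed.

Lemma tw_mul1r (K : fieldType) (n : nat) (f : 'Z2^n -> 'Z2^n -> 'Z_2) :
  (forall x, f x 0 = 0) ->
  forall a : group_space K n, tw_mul f a (tw_basis K 0) = a.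
Proof.
move=> f0 a; rewrite [RHS]tw_basis_decomp /tw_mul; apply: eq_bigr => x _.
rewrite (bigD1 0) //= [X in _ + X]big1 => [|y ny]; last first.
  by rewrite !tw_basisE (negPf ny) mulr0 mul0r scale0r.
by rewrite !tw_basisE eqxx mulr1 f0 !addr0 /z2sign expr0 mulr1.
Qed.

Lemma z2_addbb (b : 'Z_2) : b + b = 0.
Proof. by case: b => [[|[|[]]] //= ?]; apply/val_inj. Qed.

Lemma z2_addI2 (a b c : 'Z_2) : a = b + c -> b = a + c.
Proof. by move->; rewrite -addrA z2_addbb addr0. Qed.

Lemma tw_basis_scale_inj (K : fieldType) (n : nat) (x : 'Z2^n) (c d : K) :
  c *: tw_basis K x = d *: tw_basis K x -> c = d.
Proof.
move=> /ffunP /(_ x); rewrite !tw_scaleE tw_basisE eqxx.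
by rewrite !mulr1.
Qed.

Lemma qa_betaE (K : fieldType) (n : nat) (A : quasialgebra K n) :
  (2%:R : K) != 0 ->
  forall x y, qa_beta A x y = qa_twist A x y + qa_twist A y x.
Proof.
move=> nz2 x y; have := qa_betaP A x y.
rewrite !tw_mul_basis scalerA -z2signD [y + x]addrC.
by move/tw_basis_scale_inj/(z2sign_inj nz2)/z2_addI2.
Qed.

Lemma qa_phiE (K : fieldType) (n : nat) (A : quasialgebra K n) :
  (2%:R : K) != 0 ->
  forall x y z, qa_phi A x y z =
    qa_twist A y z + qa_twist A (x + y) z + qa_twist A x (y + z)
    + qa_twist A x y.
Proof.
move=> nz2 x y z; have := qa_phiP A x y z.
rewrite !(tw_mul_basis, tw_mulZl, tw_mulZr) !scalerA -!z2signD addrA.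
move/tw_basis_scale_inj/(z2sign_inj nz2); rewrite -addrA => /z2_addI2 ->.
by rewrite [qa_twist A x y + _]addrC addrA; congr (_ + _); rewrite addrAC.
Qed.

Lemma quasialgebra_of_betaP (K : fieldType) (n : nat)
    (f : 'Z2^n -> 'Z2^n -> 'Z_2) (x y : 'Z2^n) :
  tw_mul f (tw_basis K x) (tw_basis K y) =
  z2sign K (f x y + f y x) *: tw_mul f (tw_basis K y) (tw_basis K x).
Proof.
by rewrite !tw_mul_basis scalerA -z2signD -addrA z2_addbb addr0 [y + x]addrC.
Qed.

Lemma quasialgebra_of_phiP (K : fieldType) (n : nat)
    (f : 'Z2^n -> 'Z2^n -> 'Z_2) (x y z : 'Z2^n) :
  tw_mul f (tw_basis K x) (tw_mul f (tw_basis K y) (tw_basis K z)) =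
  z2sign K (f y z + f (x + y) z + f x (y + z) + f x y) *:
    tw_mul f (tw_mul f (tw_basis K x) (tw_basis K y)) (tw_basis K z).
Proof.
rewrite !(tw_mul_basis, tw_mulZl, tw_mulZr) !scalerA -!z2signD addrA.
congr (z2sign K _ *: _).
rewrite -[_ + f x y + f x y]addrA z2_addbb addr0 addrAC.
by rewrite -[f y z + _ + _]addrA z2_addbb addr0.
Qed.

Definition quasialgebra_of (K : fieldType) (n : nat)
    (f : 'Z2^n -> 'Z2^n -> 'Z_2)
    (f0l : forall x, f 0 x = 0) (f0r : forall x, f x 0 = 0) :
    quasialgebra K n :=
  Quasialgebra f0l f0r
    (quasialgebra_of_betaP K f) (quasialgebra_of_phiP K f).

(* Main.v *)
(* The hexagon identity
     phi(x,y,z) + phi(x,z,y) + phi(z,x,y) = beta(x+y,z) + beta(x,z) + beta(y,z)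
   and the identity (delta beta)(x,y,z) = phi(x,y,z) + phi(z,y,x) hold for every
   twist.  When phi is symmetric, the latter makes beta a 2-cocycle, symmetric
   and zero on the diagonal: the central extension that it defines is an
   elementary abelian 2-group, which splits, so beta is the coboundary of some
   alpha.  The former then expresses phi through beta, hence through alpha. *)
Require Import Defs.
From mathcomp Require Import all_boot all_order all_algebra.
From mathcomp Require Import reals.
From mathcomp Require Import complex ring.

Set Implicit Arguments.
Unset Strict Implicit.
Unset Printing Implicit Defensive.

Import GRing.Theory Num.Theory.
Local Open Scope ring_scope.

Definition cocycle (G V : zmodType) (b : G -> G -> V) :=
  forall x y z, b y z + b x (y + z) = b (x + y) z + b x y.

Section SymmetricCocycle.

Variables (G V : zmodType) (b : G -> G -> V).
Hypotheses (b_cocycle : cocycle b) (b_sym : forall x y, b x y = b y x).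

(** In the extension of [G] by [V] with law [(u, x)(v, y) = (u + v + b x y, x + y)], which is
    commutative and associative, this compares the products [(xy)(zt)] and [(xz)(yt)] of lifts. *)
Lemma sym_cocycle_interchange (x y z t : G) :
  b x y + b z t + b (x + y) (z + t) = b x z + b y t + b (x + z) (y + t).
Proof.
rewrite -[LHS]addrA -[RHS]addrA !b_cocycle [LHS]addrCA [RHS]addrCA.
rewrite [x + z + y]addrAC; congr (_ + _).
by rewrite [LHS]addrC [RHS]addrC -!b_cocycle [b y z]b_sym [y + z]addrC.
Qed.

Lemma cocycle0l (x : G) : b 0 0 = 0 -> b 0 x = 0.
Proof. by move=> b00; have := b_cocycle 0 0 x; rewrite !add0r b00 => /addrI. Qed.

End SymmetricCocycle.

Lemma z2_rV1P (s t : 'rV['Z_2]_1) : [\/ s = 0, t = 0 | s = t].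
Proof.
have E (u v : 'rV['Z_2]_1) : u 0 0 = v 0 0 -> u = v.
  by move=> e; apply/rowP => i; rewrite ord1.
have z2P (c : 'Z_2) : c = 0 \/ c = 1.
  by case: c => [[|[|[]]] //= ?]; [left | right]; apply/val_inj.
case: (z2P (s 0 0)) => hs; first by apply: Or31; apply: E; rewrite hs mxE.
case: (z2P (t 0 0)) => ht; first by apply: Or32; apply: E; rewrite ht mxE.
by apply: Or33; apply: E; rewrite hs ht.
Qed.

(** Equivalently, [x |-> (a x, x)] is a homomorphic section of the extension. Induction on [n]
    splits off the first coordinate. *)
Lemma sym_cocycle_split (V : zmodType) (n : nat) (b : 'Z2^n -> 'Z2^n -> V) :
    cocycle b -> (forall x y, b x y = b y x) -> (forall x, b x x = 0) ->
  exists a : 'Z2^n -> V, forall x y, a (x + y) = a x + a y + b x y.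
Proof.
elim: n b => [|n IHn] b b_cocycle b_sym b_diag.
  by exists (fun=> 0) => x y; rewrite (thinmx0 x) (thinmx0 y) b_diag !addr0.
pose l (s : 'rV['Z_2]_1) : 'Z2^(n.+1) := row_mx s 0.
pose r (v : 'Z2^n) : 'Z2^(n.+1) := row_mx (0 : 'rV_1) v.
have lD s t : l (s + t) = l s + l t by rewrite /l (@add_row_mx _ 1 1 n) addr0.
have rD v w : r (v + w) = r v + r w by rewrite /r (@add_row_mx _ 1 1 n) addr0.
have lr (x : 'rV['Z_2]_(1 + n)) : x = l (lsubmx x) + r (rsubmx x).
  by rewrite /l /r (@add_row_mx _ 1 1 n) addr0 add0r hsubmxK.
have b0 x : b 0 x = 0 by apply: cocycle0l.
have l0 : l 0 = 0 by rewrite /l (@row_mx0 _ 1 1 n).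
have bl s t : b (l s) (l t) = 0.
  by case: (z2_rV1P s t) => ->; rewrite ?l0 ?b0 // b_sym b0.
have [|||a aD] := IHn (fun v w => b (r v) (r w)).
- by move=> u v w; rewrite !rD.
- by move=> v w.
- by move=> v.
pose p (x : 'rV['Z_2]_(1 + n)) := lsubmx x.
pose q (x : 'rV['Z_2]_(1 + n)) := rsubmx x.
(* By [bl], [l s |-> (0, l s)] is a section over the first coordinate; this is the [V]-component of
   its product with the section given by [a]. *)
exists (fun x => a (q x) + b (l (p x)) (r (q x))) => x y.
have pD : p (x + y) = p x + p y by apply/rowP => i; rewrite !mxE.
have qD : q (x + y) = q x + q y by apply/rowP => i; rewrite !mxE.
(* The vanishing term [b (l (p x)) (l (p y))] is inserted to reach the interchange shape. *)
rewrite pD qD aD lD rD -addrA -[b (r _) _]add0r -(bl (p x) (p y)).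
rewrite -sym_cocycle_interchange // -!lr addrA.
by congr (_ + _); rewrite addrACA.
Qed.

Section TwistIdentities.

Variables (G : zmodType) (f : G -> G -> 'Z_2).

Let beta x y := f x y + f y x.
Let phi x y z := f y z + f (x + y) z + f x (y + z) + f x y.

Lemma twist_hexagon x y z :
  phi x y z + phi x z y + phi z x y = beta (x + y) z + beta x z + beta y z.
Proof.
rewrite /phi /beta [z + y]addrC [z + x]addrC.
(* [c] collects the terms occurring twice on the left, as [ring] does not use [1 + 1 = 0]. *)
set s := RHS; set c := f x y + f x (y + z) + f (x + z) y.
transitivity (s + (c + c)); last by rewrite z2_addbb addr0.
by rewrite /s /c; ring.
Qed.

Lemma twist_coboundary_beta x y z :
  beta y z + beta x (y + z) + (beta (x + y) z + beta x y)
  = phi x y z + phi z y x.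
Proof. by rewrite /phi /beta [z + y]addrC [y + x]addrC; ring. Qed.

End TwistIdentities.

Lemma scalars_nat2_neq0 (R : realType) (k : scalar_kind) :
  (2%:R : scalars R k) != 0.
Proof. by case: k; rewrite /= pnatr_eq0. Qed.

Theorem theorem2 (R : realType) (k : scalar_kind) (n : nat)
    (A : quasialgebra (scalars R k) n) :
  phi_symmetric A <->
  (exists alpha : 'Z2^n -> 'Z_2, generating_function A alpha).
Proof.
split=> [phi_sym | [alpha [_ phiE]] x y z]; last first.
  (* The expression of phi through [alpha] is invariant under permutations. *)
  by rewrite !phiE [y + x]addrC [z + y]addrC [x + z + y]addrAC; split; ring.
have nz2 := scalars_nat2_neq0 R k.
have swap12 x y z : qa_phi A x y z = qa_phi A y x z by case: (phi_sym x y z).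
have swap23 x y z : qa_phi A x y z = qa_phi A x z y by case: (phi_sym x y z).
have z2_eq (b c : 'Z_2) : b + c = 0 -> b = c.
  by move/esym/z2_addI2->; rewrite add0r.
have [|||alpha alphaD] := @sym_cocycle_split _ n (qa_beta A).
- move=> x y z; apply: z2_eq; rewrite !qa_betaE // twist_coboundary_beta.
  (* Three adjacent swaps exchange the outer arguments, so the two values of phi cancel. *)
  by rewrite -!qa_phiE // (swap12 z) (swap23 y) (swap12 y) z2_addbb.
- by move=> x y; rewrite !qa_betaE // addrC.
- by move=> x; rewrite qa_betaE // z2_addbb.
have betaE x y : qa_beta A x y = alpha (x + y) + alpha x + alpha y.
  by rewrite -addrA alphaD addrAC z2_addbb add0r.
exists alpha; split=> // x y z.
have := twist_hexagon (qa_twist A) x y z.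
(* By symmetry the three phi terms of the hexagon agree, and two of them cancel. *)
rewrite -!qa_phiE // -!qa_betaE // (swap12 z) (swap23 x z) z2_addbb add0r => ->.
rewrite !betaE; set s := RHS.
(* The three beta terms contribute [alpha z] three times. *)
transitivity (s + (alpha z + alpha z)); last by rewrite z2_addbb addr0.
by rewrite /s; ring.
Qed.
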